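(* Let $a_{\mathrm{minBrake}},a_{\mathrm{maxBrake}},a_{\mathrm{maxAccel}},\rho$ be real parameters (constants, never changed by the program) and let $x_1,x_2,v_1,v_2,a_1,a_2,t$ be real state variables. Define the term $$\mathrm{safeDist}(v_1,v_2)=\max\Big(v_1\rho+\tfrac12 a_{\mathrm{maxAccel}}\rho^2+\frac{(v_1+\rho\, a_{\mathrm{maxAccel}})^2}{2a_{\mathrm{minBrake}}}-\frac{v_2^2}{2a_{\mathrm{maxBrake}}},\,0\Big),$$ the formula $\mathrm{edc}\equiv v_1\ge 0\wedge v_2\ge 0$, and the hybrid programs $$\mathrm{freeDriving}\equiv a_1:=*;\ ?(-a_{\mathrm{maxBrake}}\le a_1\le a_{\mathrm{maxAccel}});\ a_2:=*;\ ?(-a_{\mathrm{maxBrake}}\le a_2\le a_{\mathrm{maxAccel}}),$$ $$\mathrm{properResponse}\equiv\big((a_1:=*;\ ?(a_1\le -a_{\mathrm{minBrake}}))\cup(?(v_1=0);\ a_1:=0)\big);\ \big((a_2:=*;\ ?(a_2\ge -a_{\mathrm{maxBrake}}))\cup(?(v_2=0);\ a_2:=0)\big),$$ $$\alpha\equiv\big((?(\mathrm{safeDist}(v_1,v_2)\le x_2-x_1);\ \mathrm{freeDriving})\cup(?(\mathrm{safeDist}(v_1,v_2)\ge x_2-x_1);\ \mathrm{properResponse})\big);\ t:=0;\ \{x_1'=v_1,x_2'=v_2,v_1'=a_1,v_2'=a_2,t'=1\ \&\ \mathrm{edc}\wedge t\le\rho\}.$$ Let $\mathrm{Init}\equiv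 x_1\le x_2\wedge \mathrm{safeDist}(v_1,v_2)\le x_2-x_1\wedge 0<a_{\mathrm{minBrake}}<a_{\mathrm{maxBrake}}\wedge 0<a_{\mathrm{maxAccel}}\wedge \rho>0\wedge \mathrm{edc}$. Then the differential dynamic logic formula $\mathrm{Init}\rightarrow[\alpha^*](x_1\le x_2)$ is valid; that is, for every state $\nu$ satisfying $\mathrm{Init}$ and every state $\omega$ with $(\nu,\omega)\in[\![\alpha^*]\!]$, we have $\omega(x_1)\le\omega(x_2)$.
   Context: A state is a map assigning a real number to each variable. Hybrid programs denote transition relations $[\![\cdot]\!]$ on states: $(\nu,\omega)\in[\![x:=\theta]\!]$ iff $\omega$ equals $\nu$ except $\omega(x)$ is the value of $\theta$ in $\nu$; $(\nu,\omega)\in[\![x:=*]\!]$ iff $\omega$ agrees with $\nu$ except possibly at $x$ (any real value); $[\![?P]\!]=\{(\nu,\nu):\nu\models P\}$; $[\![\alpha;\beta]\!]$ is relational composition; $[\![\alpha\cup\beta]\!]=[\![\alpha]\!]\cup[\![\beta]\!]$; $[\![\alpha^*]\!]$ is the reflexive transitive closure of $[\![\alpha]\!]$; $(\nu,\omega)\in[\![\{x'=f(x)\ \&\ Q\}]\!]$ iff there exist $r\ge0$ and a differentiable $\varphi$ from $[0,r]$ to states with $\varphi(0)=\nu$, $\varphi(r)=\omega$, $\varphi$ solving the differential equations on $[0,r]$, all variables not having a differential equation constant, and $\varphi(s)\models Q$ for all $s\in[0,r]$. A formula $[\alpha]P$ holds in $\nu$ iff $P$ holds in all $\omega$ with $(\nu,\omega)\in[\![\alpha]\!]$;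 a formula is valid if it holds in all states. Car 1 (position $x_1$, velocity $v_1$, acceleration $a_1$) follows car 2 in the same driving direction. *)

(* Defs.v *)
(* Differential dynamic logic over the Stdlib real numbers. *)
From Stdlib Require Export Reals List Relation_Operators.
Open Scope R_scope.

Inductive var : Type := x1 | x2 | v1 | v2 | a1 | a2 | t.

Definition state : Type := var -> R.

Inductive term : Type :=
| Var (x : var)
| Const (c : R)
| Neg (e : term)
| Plus (e1 e2 : term)
| Minus (e1 e2 : term)
| Mult (e1 e2 : term)
| Div (e1 e2 : term)
| Pow (e : term) (n : nat)
| Max (e1 e2 : term).

Fixpoint eval (e : term) (nu : state) : R :=
  match e with
  | Var x => nu x
  | Const c => c
  | Neg e => - eval e nu
  | Plus e1 e2 => eval e1 nu + eval e2 nu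
  | Minus e1 e2 => eval e1 nu - eval e2 nu
  | Mult e1 e2 => eval e1 nu * eval e2 nu
  | Div e1 e2 => eval e1 nu / eval e2 nu
  | Pow e n => eval e nu ^ n
  | Max e1 e2 => Rmax (eval e1 nu) (eval e2 nu)
  end.

(* [ODE sys Q] is {x' = f(x) & Q}; [sys] lists the pairs (x, f), each left-hand
   side being meant to occur once. *)
Inductive formula : Type :=
| Le (e1 e2 : term)
| Lt (e1 e2 : term)
| Eq (e1 e2 : term)
| Not (P : formula)
| And (P Q : formula)
| Imp (P Q : formula)
| Box (a : program) (P : formula)
with program : Type :=
| Assign (x : var) (e : term)
| AssignAny (x : var)
| Test (P : formula)
| Seq (a b : program)
| Choice (a b : program)
| Star (a : program)
| ODE (sys : list (var * term)) (Q : formula).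

(* [D_in] is the derivative relative to the interval: one-sided at the
   endpoints, and no constraint when r = 0. *)
Definition solves (sys : list (var * term)) (r : R) (phi : R -> state) : Prop :=
  (forall x f, In (x, f) sys ->
     forall s, 0 <= s <= r ->
       D_in (fun u => phi u x) (fun u => eval f (phi u))
            (fun u => 0 <= u <= r) s) /\
  (forall y, ~ In y (map fst sys) ->
     forall s, 0 <= s <= r -> phi s y = phi 0 y).

Fixpoint holds (P : formula) (nu : state) {struct P} : Prop :=
  match P with
  | Le e1 e2 => eval e1 nu <= eval e2 nu
  | Lt e1 e2 => eval e1 nu < eval e2 nu
  | Eq e1 e2 => eval e1 nu = eval e2 nu
  | Not P => ~ holds P nu
  | And P Q => holds P nu /\ holds Q nu
  | Imp P Q => holds P nu -> holds Q nu
  | Box a P => forall omega, sem a nu omega -> holds P omega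
  end
with sem (a : program) (nu omega : state) {struct a} : Prop :=
  match a with
  | Assign x e =>
      omega x = eval e nu /\ forall y, y <> x -> omega y = nu y
  | AssignAny x => forall y, y <> x -> omega y = nu y
  | Test P => omega = nu /\ holds P nu
  | Seq a b => exists mu, sem a nu mu /\ sem b mu omega
  | Choice a b => sem a nu omega \/ sem b nu omega
  | Star a => clos_refl_trans state (sem a) nu omega
  | ODE sys Q =>
      exists (r : R) (phi : R -> state),
        0 <= r /\ phi 0 = nu /\ phi r = omega /\ solves sys r phi /\
        forall s, 0 <= s <= r -> holds Q (phi s)
  end.

Definition valid (P : formula) : Prop := forall nu, holds P nu.

Coercion Var : var >-> term.
Coercion Const : R >-> term.

Declare Scope term_scope.
Declare Scope formula_scope.
Declare Scope program_scope.
Delimit Scope term_scope with term.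
Delimit Scope formula_scope with fml.
Delimit Scope program_scope with hp.
Bind Scope term_scope with term.
Bind Scope formula_scope with formula.
Bind Scope program_scope with program.
Arguments Const c%_R.
Arguments Max (e1 e2)%_term.
Arguments Box a%_hp P%_fml.
Arguments Test P%_fml.
Arguments Star a%_hp.
Arguments ODE sys%_list Q%_fml.
Arguments valid P%_fml.

Notation "- e" := (Neg e) : term_scope.
Notation "e1 + e2" := (Plus e1 e2) : term_scope.
Notation "e1 - e2" := (Minus e1 e2) : term_scope.
Notation "e1 * e2" := (Mult e1 e2) : term_scope.
Notation "e1 / e2" := (Div e1 e2) : term_scope.
Notation "e ^ n" := (Pow e n%nat) : term_scope.
Notation "e1 <= e2" := (Le e1%term e2%term) : formula_scope.
Notation "e1 >= e2" := (Le e2%term e1%term) (only parsing) : formula_scope.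
Notation "e1 < e2" := (Lt e1%term e2%term) : formula_scope.
Notation "e1 > e2" := (Lt e2%term e1%term) (only parsing) : formula_scope.
Notation "e1 = e2" := (Eq e1%term e2%term) : formula_scope.
Notation "P /\ Q" := (And P Q) : formula_scope.
Notation "P -> Q" := (Imp P Q) : formula_scope.
Notation "x ::= e" := (Assign x e%term) (at level 70) : program_scope.
Notation "x ::=*" := (AssignAny x) (at level 70) : program_scope.
Notation "a ;; b" := (Seq a b) (at level 75, right associativity) : program_scope.
Notation "a ++ b" := (Choice a b) : program_scope.

Definition safeDist (a_minBrake a_maxBrake a_maxAccel rho : R) : term :=
  Max (v1 * rho + Const (1 / 2) * a_maxAccel * rho ^ 2
       + (v1 + rho * a_maxAccel) ^ 2 / (Const 2 * a_minBrake)
       - v2 ^ 2 / (Const 2 * a_maxBrake))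
      (Const 0).

Definition edc : formula := v1 >= Const 0 /\ v2 >= Const 0.

Definition freeDriving (a_maxBrake a_maxAccel : R) : program :=
  a1 ::=* ;; Test (- a_maxBrake <= a1 /\ a1 <= a_maxAccel) ;;
  a2 ::=* ;; Test (- a_maxBrake <= a2 /\ a2 <= a_maxAccel).

Definition properResponse (a_minBrake a_maxBrake : R) : program :=
  ((a1 ::=* ;; Test (a1 <= - a_minBrake)) ++
   (Test (v1 = Const 0) ;; a1 ::= Const 0)) ;;
  ((a2 ::=* ;; Test (a2 >= - a_maxBrake)) ++
   (Test (v2 = Const 0) ;; a2 ::= Const 0)).

Definition alpha (a_minBrake a_maxBrake a_maxAccel rho : R) : program :=
  ((Test (safeDist a_minBrake a_maxBrake a_maxAccel rho <= x2 - x1) ;;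
    freeDriving a_maxBrake a_maxAccel) ++
   (Test (safeDist a_minBrake a_maxBrake a_maxAccel rho >= x2 - x1) ;;
    properResponse a_minBrake a_maxBrake)) ;;
  t ::= Const 0 ;;
  ODE ((x1, Var v1) :: (x2, Var v2) :: (v1, Var a1) :: (v2, Var a2) ::
       (t, Const 1) :: nil)
      (edc /\ t <= rho).

Definition Init (a_minBrake a_maxBrake a_maxAccel rho : R) : formula :=
  x1 <= x2 /\
  safeDist a_minBrake a_maxBrake a_maxAccel rho <= x2 - x1 /\
  (Const 0 < a_minBrake /\ a_minBrake < a_maxBrake) /\
  Const 0 < a_maxAccel /\
  rho > Const 0 /\
  edc.

(* Main.v *)
(** Write [stop b x v = x + v^2 / (2 b)] for the point where a car at [x] with
    speed [v] comes to rest when braking at rate [b].  The loop invariant is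
    that both velocities are nonnegative, [x1 <= x2], and car 1 braking at
    [a_minBrake] stops no farther than car 2 braking at [a_maxBrake].  In both
    branches the last inequality persists at every instant of the continuous
    evolution: [stop] of car 2 cannot decrease since [a2 >= - a_maxBrake];
    [stop] of car 1 cannot increase when [a1 <= - a_minBrake], and in free
    driving it is bounded by the worst case built into [safeDist].  As
    [a_minBrake < a_maxBrake], the inequality gives [x1 <= x2] whenever
    [v1 >= v2], so in particular when the gap, whose derivative is [v2 - v1],
    is at an interior minimum. *)
Require Import Defs.
From Stdlib Require Import Lra Psatz.

(** * Functions with affine derivative on a closed interval *)

Definition clamp (r u : R) : R := Rmax 0 (Rmin r u).

Lemma clamp_range (r u : R) : 0 <= r -> 0 <= clamp r u <= r.
Proof.
unfold clamp, Rmax, Rmin; intros hr.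
destruct (Rle_dec r u); destruct (Rle_dec 0 _); lra.
Qed.

Lemma clamp_id (r u : R) : 0 <= u <= r -> clamp r u = u.
Proof.
unfold clamp, Rmax, Rmin; intros hu.
destruct (Rle_dec r u); destruct (Rle_dec 0 _); lra.
Qed.

Lemma clamp_lipschitz (r u w : R) :
  Rabs (clamp r u - clamp r w) <= Rabs (u - w).
Proof.
unfold clamp, Rmax, Rmin, Rabs.
destruct (Rle_dec r u); destruct (Rle_dec r w); repeat destruct (Rle_dec 0 _);
  repeat destruct (Rcase_abs _); lra.
Qed.

(* The mean value theorem of the library asks for two-sided continuity at the
   endpoints, which [f o clamp r] has even though [f] need not. *)
Lemma D_in_zero_constant (f : R -> R) (r : R) :
  (forall s, 0 <= s <= r -> D_in f (fun _ => 0) (fun u => 0 <= u <= r) s) ->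
  forall s, 0 <= s <= r -> f s = f 0.
Proof.
intros hf s hs.
set (g := fun u => f (clamp r u)).
assert (hder : forall u, 0 < u < r -> derivable_pt_lim g u 0).
{ intros u hu.
  apply (proj1 (derivable_pt_lim_D_in g (fun _ => 0) u)).
  intros eps heps.
  destruct (hf u ltac:(lra) eps heps) as [d [hd hlim]].
  (* This radius keeps [w] strictly inside the interval, where [clamp] is the identity. *)
  exists (Rmin d (Rmin u (r - u))); split.
  - apply Rlt_gt; repeat apply Rmin_glb_lt; lra.
  - intros w [[_ hne] hw]; simpl in hw; unfold Rdist in hw.
    assert (hwd := Rlt_le_trans _ _ _ hw (Rmin_l _ _)).
    assert (hw2 := Rlt_le_trans _ _ _ hw (Rmin_r _ _)).
    assert (hwu := Rlt_le_trans _ _ _ hw2 (Rmin_l _ _)).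
    assert (hwr := Rlt_le_trans _ _ _ hw2 (Rmin_r _ _)).
    apply Rabs_def2 in hwu; apply Rabs_def2 in hwr.
    unfold g; rewrite !clamp_id by lra.
    apply hlim; repeat split; try lra; assumption. }
assert (pr : forall u, 0 < u < r -> derivable_pt g u).
{ intros u hu; exists 0; exact (hder u hu). }
assert (hcont : forall u, 0 <= u <= r -> continuity_pt g u).
{ intros u hu eps heps.
  assert (hc := cont_deriv _ _ _ _ (hf u hu)).
  destruct (hc eps heps) as [d [hd hlim]].
  exists d; split; [exact hd|].
  intros w [_ hw]; simpl in *; unfold Rdist in *; unfold g.
  rewrite (clamp_id r u hu).
  (* The limit of [f] at [u] excludes [u] itself, which [clamp] may hit when [u] is an endpoint. *)
  destruct (Req_dec (clamp r w) u) as [->|hne].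
  - rewrite Rminus_diag, Rabs_R0; exact heps.
  - apply hlim; split.
    + split; [apply clamp_range; lra|auto].
    + apply Rle_lt_trans with (2 := hw).
      rewrite <- (clamp_id r u hu) at 1; apply clamp_lipschitz. }
assert (hg : g s = g 0).
{ apply (null_derivative_loc g 0 r pr hcont); [|exact hs].
  intros u hu; apply derive_pt_eq_0; auto. }
unfold g in hg; rewrite !clamp_id in hg by lra; exact hg.
Qed.

(** Subtracting an explicit quadratic antiderivative leaves a function with zero derivative. *)
Lemma D_in_affine_derivative (f : R -> R) (r c d : R) :
  (forall s, 0 <= s <= r ->
     D_in f (fun u => c + d * u) (fun u => 0 <= u <= r) s) ->
  forall s, 0 <= s <= r -> f s = f 0 + c * s + d * s ^ 2 / 2.
Proof.
intros hf s hs.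
set (p := fun u => c * u + d * u ^ 2 / 2).
assert (hp : forall u, D_in p (fun u => c + d * u) (fun u => 0 <= u <= r) u).
{ intros u.
  assert (hlim : derivable_pt_lim p u (c + d * u)).
  { unfold p.
    replace (c + d * u) with (c * 1 + d / 2 * (INR 2 * u ^ 1))
      by (simpl; field).
    apply (derivable_pt_lim_ext
      (plus_fct (mult_real_fct c id) (mult_real_fct (d / 2) (fun u => u ^ 2)))).
    - intros w; unfold plus_fct, mult_real_fct, id; field.
    - apply derivable_pt_lim_plus; apply derivable_pt_lim_scal.
      + apply derivable_pt_lim_id.
      + apply (derivable_pt_lim_pow u 2). }
  apply (proj2 (derivable_pt_lim_D_in p (fun u => c + d * u) u)) in hlim.
  unfold D_in in *; apply limit1_imp with (2 := hlim).
  intros w [_ hw]; split; [exact I|exact hw]. }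
assert (hz : f s - p s = f 0 - p 0).
{ apply (D_in_zero_constant (fun u => f u - p u) r); [|exact hs].
  intros u hu.
  assert (hm := Dminus _ _ _ _ _ _ (hf u hu) (hp u)).
  unfold D_in in *; rewrite Rminus_diag in hm; exact hm. }
unfold p in hz; simpl in hz |- *; lra.
Qed.

Lemma constant_acceleration (y v : R -> R) (r a : R) :
  (forall s, 0 <= s <= r -> D_in y v (fun u => 0 <= u <= r) s) ->
  (forall s, 0 <= s <= r -> D_in v (fun _ => a) (fun u => 0 <= u <= r) s) ->
  forall s, 0 <= s <= r ->
    v s = v 0 + a * s /\ y s = y 0 + v 0 * s + a * s ^ 2 / 2.
Proof.
intros hy hv.
assert (hv' : forall s, 0 <= s <= r -> v s = v 0 + a * s).
{ intros s hs; rewrite (D_in_affine_derivative v r a 0); [lra| |exact hs].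
  intros u hu; unfold D_in; rewrite Rmult_0_l, Rplus_0_r; exact (hv u hu). }
intros s hs; split; [exact (hv' s hs)|].
apply (D_in_affine_derivative y r (v 0) a); [|exact hs].
intros u hu; unfold D_in; rewrite <- (hv' u hu); exact (hy u hu).
Qed.

(** * Stopping points under constant acceleration *)

Definition stop (b x v : R) : R := x + v ^ 2 / (2 * b).

(** When [b] is positive and [s] and both velocities are nonnegative, only the factor [b + a] of the
    increment can be negative; both monotonicity lemmas read off its sign. *)
Lemma stop_evolution (b x v a s : R) :
  b <> 0 ->
  stop b (x + v * s + a * s ^ 2 / 2) (v + a * s)
  = stop b x v + s * (v + (v + a * s)) * (b + a) / (2 * b).
Proof. intros hb; unfold stop; field; exact hb. Qed.

Lemma stop_evolution_ge (b x v a s : R) :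
  0 < b -> - b <= a -> 0 <= s -> 0 <= v -> 0 <= v + a * s ->
  stop b x v <= stop b (x + v * s + a * s ^ 2 / 2) (v + a * s).
Proof.
intros hb ha hs hv hvs; rewrite stop_evolution by lra.
assert (0 <= s * (v + (v + a * s)) * (b + a) / (2 * b)); [|lra].
apply Rle_mult_inv_pos; [|lra].
repeat apply Rmult_le_pos; lra.
Qed.

Lemma stop_evolution_le (b x v a s : R) :
  0 < b -> a <= - b \/ (v = 0 /\ a = 0) -> 0 <= s -> 0 <= v ->
  0 <= v + a * s ->
  stop b (x + v * s + a * s ^ 2 / 2) (v + a * s) <= stop b x v.
Proof.
intros hb ha hs hv hvs; rewrite stop_evolution by lra.
destruct ha as [ha | [-> ->]].
- assert (0 <= s * (v + (v + a * s)) * (- (b + a)) / (2 * b)).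
  { apply Rle_mult_inv_pos; [|lra].
    repeat apply Rmult_le_pos; lra. }
  lra.
- rewrite Rmult_0_l, !Rplus_0_r, Rmult_0_r, Rmult_0_l, Rdiv_0_l; lra.
Qed.

(** Position and velocity are each bounded by their values under acceleration [A] for the full time
    [rho]; squaring keeps the velocity bound since [v + a * s] is nonnegative. *)
Lemma stop_evolution_bound (b x v a A s rho : R) :
  0 < b -> 0 < A -> a <= A -> 0 <= s <= rho -> 0 <= v -> 0 <= v + a * s ->
  stop b (x + v * s + a * s ^ 2 / 2) (v + a * s)
  <= x + v * rho + 1 / 2 * A * rho ^ 2 + (v + rho * A) ^ 2 / (2 * b).
Proof.
intros hb hA ha hs hv hvs; unfold stop.
assert (a * s <= A * rho) by nra.
assert (a * s ^ 2 <= A * rho ^ 2).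
{ assert (s ^ 2 <= rho ^ 2) by (apply pow_incr; lra).
  assert (0 <= s ^ 2) by apply pow2_ge_0.
  nra. }
assert (v * s <= v * rho) by nra.
assert ((v + a * s) ^ 2 / (2 * b) <= (v + rho * A) ^ 2 / (2 * b)).
{ apply Rmult_le_compat_r; [left; apply Rinv_0_lt_compat; lra|].
  apply pow_incr; lra. }
lra.
Qed.

(** A car that is at least as fast and brakes more weakly has at least as long a braking
    distance. *)
Lemma stop_le_position_le (b B y z v w : R) :
  0 < b < B -> 0 <= w <= v -> stop b y v <= stop B z w -> y <= z.
Proof.
unfold stop; intros hb hv h.
assert (w ^ 2 / (2 * B) <= v ^ 2 / (2 * b)); [|lra].
unfold Rdiv; apply Rmult_le_compat.
- apply pow2_ge_0.
- left; apply Rinv_0_lt_compat; lra.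
- apply pow_incr; lra.
- apply Rinv_le_contravar; lra.
Qed.

Lemma no_collision (b B y z v w a c r : R) :
  0 < b < B -> 0 <= r -> y <= z ->
  (forall s, 0 <= s <= r ->
     0 <= w + c * s /\
     stop b (y + v * s + a * s ^ 2 / 2) (v + a * s)
     <= stop B (z + w * s + c * s ^ 2 / 2) (w + c * s)) ->
  y + v * r + a * r ^ 2 / 2 <= z + w * r + c * r ^ 2 / 2.
Proof.
intros hb hr hyz hstop.
assert (hpos : forall s, 0 <= s <= r -> w + c * s <= v + a * s ->
  y + v * s + a * s ^ 2 / 2 <= z + w * s + c * s ^ 2 / 2).
{ intros s hs hle; destruct (hstop s hs) as [hw hst].
  apply (stop_le_position_le b B _ _ (v + a * s) (w + c * s)); auto. }
destruct (Rle_dec (w + c * r) (v + a * r)) as [hle|hlt].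
{ apply hpos; lra. }
destruct (Rle_dec v w) as [hvw|hvw].
(* The relative velocity is affine in time and nonnegative at both ends; the gap changes by [r]
   times the mean of its end values. *)
{ nra. }
(* The velocities agree at time [tau], where the gap is minimal. *)
assert (hac : 0 < c - a) by nra.
set (tau := (v - w) / (c - a)).
assert (htau : tau * (c - a) = v - w) by (unfold tau; field; lra).
assert (h0 : 0 <= tau) by (apply Rle_mult_inv_pos; lra).
assert (h1 : tau <= r) by nra.
assert (hgap := hpos tau (conj h0 h1) ltac:(lra)).
(* Completing the square, the gap at [r] exceeds the gap at [tau] by half of this term. *)
assert (0 <= (c - a) * (r - tau) ^ 2)
  by (apply Rmult_le_pos; [lra|apply pow2_ge_0]).
nra.
Qed.

(** * Solutions of the continuous dynamics *)

Definition plant (rho : R) : program :=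
  ODE ((x1, Var v1) :: (x2, Var v2) :: (v1, Var a1) :: (v2, Var a2) ::
       (t, Const 1) :: nil)
      (edc /\ t <= rho).

(** Accelerations have no equation, hence stay constant. The clock [t] runs from 0 at unit rate, so
    the domain constraint gives [r <= rho]; the velocity signs come from [edc] at each instant. *)
Lemma plant_evolution (rho : R) (nu omega : state) :
  nu t = 0 -> sem (plant rho) nu omega ->
  exists r, 0 <= r <= rho /\
    (forall s, 0 <= s <= r ->
       0 <= nu v1 + nu a1 * s /\ 0 <= nu v2 + nu a2 * s) /\
    omega x1 = nu x1 + nu v1 * r + nu a1 * r ^ 2 / 2 /\
    omega x2 = nu x2 + nu v2 * r + nu a2 * r ^ 2 / 2 /\
    omega v1 = nu v1 + nu a1 * r /\
    omega v2 = nu v2 + nu a2 * r.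
Proof.
intros ht [r [phi [hr [<- [<- [[hode hcst] hQ]]]]]].
assert (ha1 : forall s, 0 <= s <= r -> phi s a1 = phi 0 a1)
  by (apply hcst; simpl; intuition discriminate).
assert (ha2 : forall s, 0 <= s <= r -> phi s a2 = phi 0 a2)
  by (apply hcst; simpl; intuition discriminate).
assert (hx1 := hode x1 (Var v1) ltac:(simpl; auto 10)).
assert (hx2 := hode x2 (Var v2) ltac:(simpl; auto 10)).
assert (hv1 := hode v1 (Var a1) ltac:(simpl; auto 10)).
assert (hv2 := hode v2 (Var a2) ltac:(simpl; auto 10)).
assert (hT := hode t (Const 1) ltac:(simpl; auto 10)).
assert (hcar1 := constant_acceleration (fun u => phi u x1) (fun u => phi u v1)
  r (phi 0 a1) hx1).
assert (hcar2 := constant_acceleration (fun u => phi u x2) (fun u => phi u v2)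
  r (phi 0 a2) hx2).
specialize (hcar1 ltac:(intros s hs; unfold D_in; rewrite <- (ha1 s hs);
  exact (hv1 s hs))).
specialize (hcar2 ltac:(intros s hs; unfold D_in; rewrite <- (ha2 s hs);
  exact (hv2 s hs))).
assert (htime : phi r t = phi 0 t + 1 * r + 0 * r ^ 2 / 2).
{ apply (D_in_affine_derivative (fun u => phi u t) r); [|lra].
  intros s hs; unfold D_in; rewrite Rmult_0_l, Rplus_0_r; exact (hT s hs). }
exists r; split; [|split].
- destruct (hQ r ltac:(lra)) as [_ htr]; simpl in htr; lra.
- intros s hs; destruct (hQ s hs) as [[h1 h2] _]; simpl in h1, h2.
  rewrite <- (proj1 (hcar1 s hs)), <- (proj1 (hcar2 s hs)); auto.
- destruct (hcar1 r ltac:(lra)); destruct (hcar2 r ltac:(lra)); auto.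
Qed.

(** * Preservation of the loop invariant *)

Definition braking_safe (b B : R) (nu : state) : Prop :=
  0 <= nu v1 /\ 0 <= nu v2 /\ nu x1 <= nu x2 /\
  stop b (nu x1) (nu v1) <= stop B (nu x2) (nu v2).

Lemma safeDist_le (b B A rho : R) (nu : state) (d : R) :
  eval (safeDist b B A rho) nu <= d ->
  0 <= d /\
  nu v1 * rho + 1 / 2 * A * rho ^ 2 + (nu v1 + rho * A) ^ 2 / (2 * b)
  - nu v2 ^ 2 / (2 * B) <= d.
Proof.
intros h; split; eapply Rle_trans; [|exact h| |exact h].
- apply Rmax_r.
- apply Rmax_l.
Qed.

Lemma plant_braking_safe (b B A rho : R) (nu omega : state) :
  0 < b < B -> 0 < A -> nu t = 0 -> nu x1 <= nu x2 -> - B <= nu a2 ->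
  (nu a1 <= A /\ eval (safeDist b B A rho) nu <= nu x2 - nu x1) \/
  ((nu a1 <= - b \/ (nu v1 = 0 /\ nu a1 = 0)) /\
   stop b (nu x1) (nu v1) <= stop B (nu x2) (nu v2)) ->
  sem (plant rho) nu omega -> braking_safe b B omega.
Proof.
intros hb hA ht hx ha2 hctrl hsem.
destruct (plant_evolution rho nu omega ht hsem)
  as [r [hr [hv [e1 [e2 [e3 e4]]]]]].
assert (hstop : forall s, 0 <= s <= r -> 0 <= nu v2 + nu a2 * s /\
  stop b (nu x1 + nu v1 * s + nu a1 * s ^ 2 / 2) (nu v1 + nu a1 * s)
  <= stop B (nu x2 + nu v2 * s + nu a2 * s ^ 2 / 2) (nu v2 + nu a2 * s)).
{ intros s hs; destruct (hv s hs) as [h1 h2].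
  destruct (hv 0 ltac:(lra)) as [h10 h20].
  split; [exact h2|].
  (* The initial stopping point of car 2 separates the two stopping points at time [s]. *)
  apply Rle_trans with (stop B (nu x2) (nu v2));
    [|apply stop_evolution_ge; lra].
  destruct hctrl as [[ha1 hd]|[ha1 hst]].
  - apply safeDist_le in hd.
    assert (hbd := stop_evolution_bound b (nu x1) (nu v1) (nu a1) A s rho).
    specialize (hbd ltac:(lra) hA ha1 ltac:(lra) ltac:(lra) h1).
    unfold stop at 2; lra.
  - apply Rle_trans with (2 := hst); apply stop_evolution_le; auto; lra. }
unfold braking_safe; rewrite e1, e2, e3, e4.
destruct (hv r ltac:(lra)).
repeat split; auto.
- apply (no_collision b B); auto; lra.
- apply hstop; lra.
Qed.

Lemma alpha_braking_safe (b B A rho : R) (nu omega : state) :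
  0 < b < B -> 0 < A -> braking_safe b B nu ->
  sem (alpha b B A rho) nu omega -> braking_safe b B omega.
Proof.
intros hb hA [h1 [h2 [hx hst]]] [mu [hctrl [mu' [[et ht] hplant]]]].
simpl in et.
(* The control writes only accelerations, so tests and invariant in [nu] carry over to [mu]. *)
assert (hmu : mu x1 = nu x1 /\ mu x2 = nu x2 /\ mu v1 = nu v1 /\
  mu v2 = nu v2 /\ - B <= mu a2 /\
  ((mu a1 <= A /\ eval (safeDist b B A rho) nu <= nu x2 - nu x1) \/
   (mu a1 <= - b \/ (nu v1 = 0 /\ mu a1 = 0)))).
{ destruct hctrl as [[m0 [[-> hd] hfree]]|[m0 [[-> _] hresp]]].
  - destruct hfree as [m1 [g1 [m2 [[-> [_ hA1]] [m3 [g2 [-> [hB2 _]]]]]]]].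
    simpl in *.
    rewrite (g2 a1), !g2, !g1 by discriminate.
    repeat split; auto.
  - destruct hresp as [m1 [r1 r2]].
    assert (k1 : (forall y, y <> a1 -> m1 y = nu y) /\
      (m1 a1 <= - b \/ (nu v1 = 0 /\ m1 a1 = 0))).
    { destruct r1 as [[m [g [-> h]]]|[m [[-> h] [e g]]]]; simpl in *; auto. }
    assert (k2 : (forall y, y <> a2 -> mu y = m1 y) /\ - B <= mu a2).
    { destruct r2 as [[m [g [-> h]]]|[m [[-> h] [e g]]]]; simpl in *.
      - auto.
      (* Here car 2 stands still with [a2] set to 0, and [- B <= 0]. *)
      - split; [exact g|lra]. }
    destruct k1 as [g1 k1]; destruct k2 as [g2 k2].
    rewrite (g2 a1), !g2, !g1 by discriminate.
    repeat split; auto. }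
destruct hmu as [e1 [e2 [e3 [e4 [ha2 hc]]]]].
apply (plant_braking_safe b B A rho mu' omega); auto.
- rewrite !ht, e1, e2 by discriminate; exact hx.
- rewrite ht by discriminate; exact ha2.
- unfold safeDist in *; simpl in *.
  rewrite !ht, e1, e2, e3, e4 by discriminate.
  destruct hc; auto.
Qed.

Lemma Init_braking_safe (b B A rho : R) (nu : state) :
  holds (Init b B A rho) nu ->
  0 < b < B /\ 0 < A /\ braking_safe b B nu.
Proof.
intros [hx [hd [hb [hA [hrho [h1 h2]]]]]].
change (eval (safeDist b B A rho) nu <= nu x2 - nu x1) in hd.
simpl in hx, hb, hA, hrho, h1, h2.
apply safeDist_le in hd.
repeat split; try lra.
(* An evolution of duration 0: the worst case in [safeDist] dominates the present stopping point. *)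
assert (hbd := stop_evolution_bound b (nu x1) (nu v1) 0 A 0 rho).
specialize (hbd ltac:(lra) hA ltac:(lra) ltac:(lra) h1 ltac:(lra)).
unfold stop in *.
replace (nu v1 + 0 * 0) with (nu v1) in hbd by ring.
lra.
Qed.

Theorem theorem1 (a_minBrake a_maxBrake a_maxAccel rho : R) :
  valid (Init a_minBrake a_maxBrake a_maxAccel rho ->
         Box (Star (alpha a_minBrake a_maxBrake a_maxAccel rho)) (x1 <= x2)).
Proof.
intros nu hinit omega hrun.
destruct (Init_braking_safe _ _ _ _ _ hinit) as [hb [hA hinv]].
assert (hsafe : braking_safe a_minBrake a_maxBrake omega).
(* The initial condition need not survive an iteration, so only the invariant may enter the
   induction hypotheses. *)
{ clear hinit; induction hrun as [m m' hstep|m|m m' m'' _ IH1 _ IH2]; auto.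
  apply (alpha_braking_safe _ _ _ _ _ _ hb hA hinv hstep). }
apply hsafe.
Qed.
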